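(* Let $w$ be a uniformly recurrent infinite word over a finite alphabet, and let $A=\{u_1,u_2,\ldots,u_n,\ldots\}$ be an infinite family of pairwise different non-empty factors of $w$ such that for every finite subset $\{v_1,\ldots,v_k\}\subseteq A$ (with the $v_i$ distinct) and every permutation $\sigma$ of $\{1,\ldots,k\}$, the word $v_{\sigma(1)}v_{\sigma(2)}\cdots v_{\sigma(k)}$ is a factor of $w$. Then either $w$ is periodic, or the factor complexity of $w$ is greater than linear, i.e. there is no constant $C$ with $p_w(n)\le Cn$ for all $n\ge 1$.
   Context: An infinite word $w$ is uniformly recurrent if every factor of $w$ occurs in $w$ infinitely often with bounded gaps. The factor complexity $p_w(n)$ is the number of distinct factors of $w$ of length $n$. A word $w$ is periodic if $w=u^\omega=uuu\cdots$ for some non-empty finite word $u$. *)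

(* Defs.v *)
From mathcomp Require Import all_boot perm boolp.

Set Implicit Arguments.
Unset Strict Implicit.
Unset Printing Implicit Defensive.

Definition occurs_at (T : Type) (w : nat -> T) (u : seq T) (i : nat) : Prop :=
  mkseq (fun j => w (i + j)) (size u) = u.

Definition factor (T : Type) (w : nat -> T) (u : seq T) : Prop :=
  exists i, occurs_at w u i.

Definition uniformly_recurrent (T : Type) (w : nat -> T) : Prop :=
  forall u, factor w u ->
    (forall N, exists2 i, N <= i & occurs_at w u i) /\
    (exists d, forall i, occurs_at w u i ->
       exists2 j, i < j <= i + d & occurs_at w u j).

Definition factor_complexity (T : finType) (w : nat -> T) (n : nat) : nat :=
  #|[set u : n.-tuple T | `[< factor w u >]]|.

(* The infinite word u^omega for the non-empty word u = x :: s; the default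
   value of nth is never reached. *)
Definition omega_power (T : Type) (x : T) (s : seq T) (i : nat) : T :=
  nth x (x :: s) (i %% size (x :: s)).

Definition periodic (T : Type) (w : nat -> T) : Prop :=
  exists x s, w =1 omega_power x s.

(* Main.v *)
Require Import Defs.
From mathcomp Require Import all_boot perm boolp.
From mathcomp Require Import zify.

(** Along a suitable sequence of indices the words [u m] converge, from the left
to a right-infinite word [P] and from the right to a left-infinite word [S], so
[S P] and [S (u m) P] have all their factors in the language of [w]. If [w] is
not periodic then [S] differs from [S (u m)]; the longest common suffix [y] of
the two makes [y P] a left special infinite word, and [y] is arbitrarily long
since the [u m] converge to [S] from the right. The words [y P] are pairwise
distinct, again by aperiodicity, hence for each [M] there are at least [M] left
special factors of every large length, which forces
[p(n+1) - p(n) >= M] for all large [n]. *)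

Set Implicit Arguments.
Unset Strict Implicit.
Unset Printing Implicit Defensive.

(** * Pigeonhole and compactness *)

Lemma mkseqD (T : Type) (f : nat -> T) (m n : nat) :
  mkseq f (m + n) = mkseq f m ++ mkseq (fun i => f (m + i)) n.
Proof.
rewrite /mkseq iotaD map_cat; congr (_ ++ _).
by rewrite add0n -[X in iota X]addn0 iotaDl -map_comp.
Qed.

Lemma pigeonhole_infinite (F : finType) (I : nat -> Prop) (f : nat -> F) :
  (forall M, exists2 m, M <= m & I m) ->
  exists a, forall M, exists2 m, M <= m & I m /\ f m = a.
Proof.
move=> Iinf; apply: contrapT => /forallNP noa.
have /choice[b bP] (a : F) : exists M, forall m, M <= m -> I m -> f m <> a.
  have /existsNP[M HM] := noa a.
  by exists M => m Mm Im fm; apply: HM; exists m.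
have [m bm Im] := Iinf (\max_a b a).
by apply: (bP (f m) m) => //; apply: leq_trans bm; exact: leq_bigmax.
Qed.

(** Compactness, as in König's lemma: a prefix shared by infinitely many [g m] has a one-letter
    extension with the same property, and [h] chooses that letter. *)
Lemma cluster_point (F : finType) (g : nat -> nat -> F) :
  exists G : nat -> F, forall N M, exists2 m, M <= m & mkseq (g m) N = mkseq G N.
Proof.
pose inf p := forall M, exists2 m, M <= m & mkseq (g m) (size p) = p.
have /choice[h hP] (p : seq F) : exists a, inf p -> inf (rcons p a).
  case: (pselect (inf p)) => [pinf|]; last by exists (g 0 0).
  have [a aP] := pigeonhole_infinite (g^~ (size p)) pinf.
  exists a => _ M; have [m Mm [mp ma]] := aP M.
  by exists m; rewrite // size_rcons mkseqS mp ma.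
pose pref N := iter N (fun p => rcons p (h p)) [::].
have prefE N : mkseq (h \o pref) N = pref N.
  by elim: N => // N IHN; rewrite mkseqS IHN.
have pref_inf N : inf (pref N).
  by elim: N => [M|N IHN]; [exists M | exact: hP].
exists (h \o pref) => N M; have [m Mm mN] := pref_inf N M.
exists m => //; rewrite prefE -[RHS]mN; congr mkseq.
by rewrite -prefE size_mkseq.
Qed.

(** A finite alphabet has finitely many words shorter than [N], so infinitely many short [u m] would
    repeat one of them. *)
Lemma injective_size_unbounded (T : finType) (u : nat -> seq T) (N : nat) :
  injective u -> exists M, forall m, M <= m -> N <= size (u m).
Proof.
move=> u_inj; apply: contrapT => /forallNP short.
have shortP M : exists2 m, M <= m & size (u m) < N.
  have /existsNP[m /not_implyP[Mm /negP]] := short M.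
  by rewrite -ltnNge; exists m.
have [s sP] : exists s : N.-bseq T, forall M, exists2 m, M <= m &
    size (u m) < N /\ insub_bseq N (u m) = s.
  exact: (pigeonhole_infinite (fun m => insub_bseq N (u m)) shortP).
have [m _ [ms sm]] := sP 0.
have [m' mm' [ms' /(congr1 val)]] := sP m.+1; rewrite -sm.
rewrite !insubdK ?[_ \in _]ltnW // => /u_inj mE.
by rewrite mE ltnn in mm'.
Qed.

(** * Factors and periodicity *)

Section Factors.

Variables (T : Type) (w : nat -> T).

Lemma factor_infix a b c : factor w (a ++ b ++ c) -> factor w b.
Proof.
move=> [i]; rewrite /occurs_at !size_cat mkseqD => /(congr1 (drop (size a))).
rewrite !drop_size_cat ?size_mkseq // mkseqD => /(congr1 (take (size b))).
rewrite !take_size_cat ?size_mkseq // => bE; exists (i + size a).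
by rewrite /occurs_at -[RHS]bE; apply: eq_mkseq => j; rewrite addnA.
Qed.

Lemma factor_catl a b : factor w (a ++ b) -> factor w a.
Proof. exact: (@factor_infix [::]). Qed.

Lemma factor_catr a b : factor w (a ++ b) -> factor w b.
Proof. by move=> ?; apply: (@factor_infix a b [::]); rewrite cats0. Qed.

Lemma occurs_at_nth x v i j : occurs_at w v i -> j < size v ->
  nth x v j = w (i + j).
Proof. by move=> <-; rewrite size_mkseq => jv; rewrite nth_mkseq. Qed.

Lemma periodicP q : 0 < q -> (forall i, w (i + q) = w i) -> periodic w.
Proof.
case: q => // q _ wq; exists (w 0), (mkseq (fun i => w i.+1) q) => i; rewrite /omega_power.
have -> : w 0 :: mkseq (fun i => w i.+1) q = mkseq w q.+1.
  by rewrite -add1n mkseqD.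
rewrite size_mkseq nth_mkseq ?ltn_mod //.
rewrite {1}(divn_eq i q.+1) addnC; elim: (i %/ q.+1) => [|n IHn].
  by rewrite addn0.
by rewrite mulSn (addnC q.+1) addnA wq.
Qed.

(** A window of length [q + 1] recurs with bounded gaps, hence inside a long factor of period [q],
    where its first and last letters must agree. *)
Lemma uniformly_recurrent_periodic q : uniformly_recurrent w -> 0 < q ->
  (forall N, exists v, [/\ factor w v, N <= size v &
     forall x j, j + q < size v -> nth x v (j + q) = nth x v j]) ->
  periodic w.
Proof.
move=> w_ur q0 long; apply: (periodicP q0) => i.
pose f := mkseq (fun j => w (i + j)) q.+1.
have fi : occurs_at w f i by rewrite /occurs_at size_mkseq.
have [d dP] := (w_ur f (ex_intro _ _ fi)).2.
(* This length leaves room for a whole window starting at most [d] after the start of [v]. *)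
have [v [vw dv vq]] := long (d + q).+1.
have [j ij vj] := (w_ur v vw).1 i.
(* Moving [j] to the right from [i], pass to the next occurrence of [f] whenever [j] overtakes the
   current one. *)
have [k /andP[jk kd] fk] : exists2 k, j <= k <= j + d & occurs_at w f k.
  elim: j ij {vj} => [|j IHj] ij.
    by exists i => //; lia.
  move: ij; rewrite leq_eqVlt => /orP[/eqP <-|/IHj[k jk fk]].
    by exists i => //; rewrite leqnn leq_addr.
  have [jlt|kj] := ltnP j k; first by exists k => //; lia.
  by have [k' k'P fk'] := dP k fk; exists k' => //; lia.
have wf l : l <= q -> w (i + l) = w (k + l).
  move=> lq; have lf : l < size f by rewrite size_mkseq.
  by rewrite -(occurs_at_nth (w 0) fi lf) -(occurs_at_nth (w 0) fk lf).
rewrite wf // -[i]addn0 wf // addn0.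
have := vq (w 0) (k - j).
by rewrite !(occurs_at_nth _ vj) ?addnA ?subnKC //; [apply|..]; lia.
Qed.

End Factors.

(** * Left special factors and complexity growth *)

Lemma factor_extend_left (T : Type) (w : nat -> T) v :
  uniformly_recurrent w -> factor w v -> exists a, factor w (a :: v).
Proof.
move=> w_ur /w_ur[/(_ 1)[i i0 vi] _]; exists (w i.-1), i.-1.
rewrite /occurs_at /= -add1n mkseqD /= addn0; congr (_ :: _).
by rewrite -[RHS]vi; apply: eq_mkseq => j; rewrite addnA addn1 prednK.
Qed.

Definition left_special (T : Type) (w : nat -> T) (v : seq T) : Prop :=
  exists a b, [/\ a <> b, factor w (a :: v) & factor w (b :: v)].

(** Recurrence extends each factor to the left, and a left special one a second time by another
    letter; the two families of extensions are disjoint. *)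
Lemma left_special_complexity (T : finType) (w : nat -> T) n
    (W : {set n.-tuple T}) :
  uniformly_recurrent w -> (forall v : n.-tuple T, v \in W -> left_special w v) ->
  factor_complexity w n + #|W| <= factor_complexity w n.+1.
Proof.
move=> w_ur Wls.
have /choice[e eP] (v : n.-tuple T) : exists e : T * T,
    (factor w v -> factor w (e.1 :: v)) /\
    (v \in W -> e.1 <> e.2 /\ factor w (e.2 :: v)).
  have [/Wls[a [b [ab av bv]]]|vW] := boolP (v \in W); first by exists (a, b).
  case: (pselect (factor w v)) => [/(factor_extend_left w_ur)[a av]|nv].
    by exists (a, a).
  by exists (w 0, w 0).
rewrite /factor_complexity; set F := [set _ | _]; set F' := [set _ | _].
pose ext (h : T * T -> T) (v : n.-tuple T) := [tuple of h (e v) :: v].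
have ext_inj h : injective (ext h).
  by move=> v v' /(congr1 val) [_] /val_inj.
rewrite -(card_imset F (ext_inj fst)) -(card_imset W (ext_inj snd)).
have := (leq_card_setU (ext fst @: F) (ext snd @: W)).2.
have -> : [disjoint ext fst @: F & ext snd @: W].
  rewrite disjoints_subset; apply/subsetP => _ /imsetP[v _ ->].
  rewrite inE; apply/imsetP => -[v' v'W /(congr1 val)[ee /val_inj vE]].
  by rewrite -vE in v'W ee; have [] := (eP v).2 v'W.
move=> /eqP <-.
apply/subset_leq_card/subsetP => _ /setUP[]/imsetP[v vP ->]; rewrite inE /=.
  by apply/asboolP/(eP v).1; move: vP; rewrite inE => /asboolP.
by apply/asboolP; have [] := (eP v).2 vP.
Qed.

Lemma superlinear_of_increments (p : nat -> nat) :
  (forall M, exists n0, forall n, n0 <= n -> p n + M <= p n.+1) ->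
  ~ exists C, forall n, 1 <= n -> p n <= C * n.
Proof.
move=> incr [C pC]; have [n0 n0P] := incr C.+1.
have lower k : C.+1 * k <= p (n0 + k).
  elim: k => [|k IHk]; first by rewrite muln0.
  by rewrite addnS; have := n0P _ (leq_addr k n0); nia.
(* With [k = C * n0 + 1], the bounds [(C + 1) * k <= p (n0 + k) <= C * (n0 + k)] would give
   [k <= C * n0]. *)
have := leq_trans (lower (C * n0).+1) (pC (n0 + (C * n0).+1) _).
by move=> /(_ ltac:(lia)); nia.
Qed.

(** Any [M] of the words [Y k] with [K k] have distinct prefixes once the length passes all pairwise
    separating positions; these are [M] left special factors. *)
Lemma complexity_superlinear (T : finType) (w : nat -> T) (K : nat -> Prop)
    (Y : nat -> nat -> T) :
  uniformly_recurrent w ->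
  (forall N, exists2 k, N <= k & K k) ->
  (forall k n, K k -> left_special w (mkseq (Y k) n)) ->
  (forall k k', k < k' -> exists i, Y k i <> Y k' i) ->
  ~ exists C, forall n, 1 <= n -> factor_complexity w n <= C * n.
Proof.
move=> w_ur Kinf Kls Ysep; apply: superlinear_of_increments => M.
have /choice[sep sepP] (kk : nat * nat) :
    exists i, kk.1 <> kk.2 -> Y kk.1 i <> Y kk.2 i.
  case: kk => k k' /=; case: (ltngtP k k') => [/Ysep|/Ysep|->]; last by exists 0.
    by move=> [i ?]; exists i.
  by move=> [i ?]; exists i => _ /esym.
have [ks [ksM ks_uniq ksK]] : exists ks : seq nat,
    [/\ size ks = M, uniq ks & forall k, k \in ks -> K k].
  elim: M => [|M [ks [ksM ks_uniq ksK]]]; first by exists [::].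
  have [k kmax Kk] := Kinf (\max_(k <- ks) k).+1; exists (k :: ks).
  split=> [|/=|k']; first by rewrite /= ksM.
    rewrite ks_uniq andbT; apply/negP => kks.
    by have := leq_bigmax_seq (P := xpredT) (F := id) _ kks isT; rewrite leqNgt kmax.
  by rewrite inE => /predU1P[->|/ksK].
exists (\max_(k <- ks) \max_(k' <- ks) (sep (k, k')).+1) => n nP.
pose tup k : n.-tuple T := [tuple Y k i | i < n].
have tupE k : tval (tup k) = mkseq (Y k) n.
  by rewrite /mkseq -val_enum_ord -map_comp.
have tup_inj : {in ks &, injective tup}.
  move=> k k' kks k'ks /(congr1 (@tval _ _)); rewrite !tupE => Ykk'.
  apply/eqP/negPn/negP => /eqP /(sepP (k, k')) /=; apply.
  have sn : sep (k, k') < n.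
    apply: leq_trans nP.
    apply: leq_trans (leq_bigmax_seq k kks isT).
    exact: (leq_bigmax_seq (F := fun k' => (sep (k, k')).+1) k' k'ks isT).
  by have := congr1 (nth (w 0) ^~ (sep (k, k'))) Ykk'; rewrite /= !nth_mkseq.
have -> : M = #|[set v in map tup ks]|.
  rewrite cardsE; apply/esym; rewrite -ksM -(size_map tup ks).
  by apply/card_uniqP; rewrite map_inj_in_uniq.
apply: left_special_complexity => // v; rewrite inE => /mapP[k kks ->].
by rewrite tupE; apply: Kls; exact: ksK.
Qed.

(** * Limits of the family of factors *)

Lemma factor_flatten (T : Type) (w : nat -> T) (u : nat -> seq T) :
  injective u ->
  (forall (k : nat) (v : 'I_k -> seq T),
      injective v -> (forall i, exists m, v i = u m) ->
      forall sigma : 'S_k, factor w (\big[cat/[::]]_(i < k) v (sigma i))) ->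
  forall s, uniq s -> factor w (flatten (map u s)).
Proof.
move=> u_inj u_concat s s_uniq.
(* The list [s] itself carries the order of the words, so the permutation is the identity. *)
have := u_concat (size s) (fun i => u (nth 0 s i)) _ _ 1%g.
under eq_bigr do rewrite perm1.
rewrite -(big_mkord xpredT (fun i => u (nth 0 s i))) -(big_nth 0 xpredT u).
rewrite /flatten foldrE big_map; apply.
  move=> i j /u_inj /eqP; rewrite nth_uniq // => /eqP; exact: val_inj.
by move=> i; exists (nth 0 s i).
Qed.

Section Limits.

Variables (T : finType) (w : nat -> T) (u : nat -> seq T).
Hypothesis w_ur : uniformly_recurrent w.
Hypothesis u_flatten : forall s, uniq s -> factor w (flatten (map u s)).
Variables (P S : nat -> T).
Hypothesis limitP : forall N M, exists m, [/\ M <= m, N <= size (u m),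
  take N (u m) = mkseq P N & take N (rev (u m)) = mkseq S N].

(** The words of [s] are framed by a [u j] ending as [S] does and a [u l] beginning as [P] does,
    with [j] and [l] beyond the indices in [s]. *)
Lemma factor_limit N s : uniq s ->
  factor w (rev (mkseq S N) ++ flatten (map u s) ++ mkseq P N).
Proof.
move=> s_uniq; pose M := (\max_(i <- s) i).+1.
have sM i : M <= i -> i \notin s.
  move=> Mi; apply/negP => si; have := leq_bigmax_seq (P := xpredT) (F := id) _ si isT.
  by rewrite leqNgt Mi.
have [j [Mj jN _ jS]] := limitP N M.
have [l [jl lN lP _]] := limitP N j.+1.
have : factor w (flatten (map u (j :: rcons s l))).
  apply: u_flatten; rewrite /= rcons_uniq s_uniq mem_rcons inE negb_or.
  by rewrite !sM ?(ltn_eqF jl) //; lia.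
rewrite /= map_rcons flatten_rcons -(cat_take_drop N (u l)) lP.
move: jS; rewrite take_rev => /(canRL revK) jS.
by rewrite -{1}(cat_take_drop (size (u j) - N) (u j)) jS -catA => /factor_catr;
  rewrite !catA => /factor_catl.
Qed.

(* The right-infinite word [y P], where [y] is the suffix of length [k] of the
   left-infinite word [... S 1 S 0]. *)
Definition limit_word k i := if i < k then S (k - i.+1) else P (i - k).

Lemma mkseq_limit_word k n :
  mkseq (limit_word k) (k + n) = rev (mkseq S k) ++ mkseq P n.
Proof.
rewrite mkseqD; congr (_ ++ _).
  apply: (@eq_from_nth _ (w 0)) => [|i]; rewrite ?size_rev !size_mkseq // => ik.
  rewrite nth_mkseq // nth_rev ?size_mkseq // nth_mkseq; last by lia.
  by rewrite /limit_word ik.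
by apply: eq_mkseq => i; rewrite /limit_word ltnNge leq_addr addKn.
Qed.

Lemma factor_limit_word k n : factor w (mkseq (limit_word k) n).
Proof.
have := @factor_limit (k + n) [::] isT; rewrite /= mkseqD rev_cat -catA.
move=> /factor_catr; rewrite -mkseq_limit_word addnA addnC mkseqD.
by apply: factor_catl.
Qed.

(** Dropping the first [k' - k] letters of the word for [k'] leaves the word for [k], so equality
    would give a period [k' - k] to arbitrarily long factors of [w]. *)
Lemma limit_word_sep k k' : ~ periodic w -> k < k' ->
  exists i, limit_word k i <> limit_word k' i.
Proof.
move=> w_aper kk'; apply: contrapT => /forallNP eqY; apply: w_aper.
apply: (@uniformly_recurrent_periodic _ _ (k' - k)); rewrite ?subn_gt0 // => N.
exists (mkseq (limit_word k') N); rewrite size_mkseq; split=> // [|x j jN].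
  exact: factor_limit_word.
rewrite !nth_mkseq //; last by lia.
rewrite -[RHS](contrapT (eqY j)) /limit_word.
rewrite (_ : (j + (k' - k) < k') = (j < k)); last by lia.
by case: ifP => _; [congr S|congr P]; lia.
Qed.

Lemma left_special_limit_word N : ~ periodic w -> (forall m, u m <> [::]) ->
  exists2 k, N <= k & forall n, left_special w (mkseq (limit_word k) n).
Proof.
move=> w_aper u_neq0; have [m [_ mN _ mS]] := limitP N 0.
set q := size (u m) in mN.
have q0 : 0 < q by rewrite lt0n size_eq0; apply/eqP.
(* [R] spells the left-infinite word [S (u m)] from right to left. *)
pose R i := if i < q then nth (w 0) (rev (u m)) i else S (i - q).
have RE n : mkseq R (q + n) = rev (u m) ++ mkseq S n.
  rewrite mkseqD; congr (_ ++ _).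
    apply: (@eq_from_nth _ (w 0)) => [|i]; rewrite ?size_rev size_mkseq // => iq.
    by rewrite nth_mkseq // /R iq.
  by apply: eq_mkseq => i; rewrite /R ltnNge leq_addr addKn.
have [k SRk kmin] : exists2 k, S k != R k & forall i, i < k -> S i = R i.
  (* If [S] equals [S (u m)], then [S] has period [q], and its long suffixes make [w] periodic. *)
  have /ex_minnP[k SRk kmin] : exists k, S k != R k.
    apply: contrapT => /forallNP SR; apply: w_aper.
    apply: (uniformly_recurrent_periodic w_ur q0) => n.
    exists (rev (mkseq S n)); rewrite size_rev size_mkseq; split=> //.
      by have := @factor_limit n [::] isT; apply: factor_catl.
    move=> x j jn; rewrite !nth_rev ?size_mkseq ?nth_mkseq; [|lia..].
    have /negP/negPn/eqP -> := SR (n - j.+1).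
    by rewrite /R ifF; [congr S|]; lia.
  exists k => // i ik; apply/eqP/negPn/negP => /kmin; lia.
(* [N <= k] since [u m] is at least [N] long and shares its last [N] letters with [S]. *)
exists k => [|n].
  rewrite leqNgt; apply/negP => kN; move/eqP: SRk; apply.
  have := congr1 (nth (w 0) ^~ k) mS; rewrite /= nth_take // nth_mkseq // => <-.
  by rewrite /R (leq_trans kN).
have SRE : mkseq R k = mkseq S k.
  by apply/eq_in_map => i; rewrite mem_iota => /kmin.
(* [S k] precedes the common suffix in [S P], and [R k] precedes it in [S (u m) P]. *)
exists (S k), (R k); split; first exact/eqP.
- apply: (@factor_catl _ _ _ (mkseq (fun i => limit_word k (n + i)) k)).
  rewrite cat_cons -mkseqD addnC mkseq_limit_word -cat_cons -rev_rcons -mkseqS.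
  have := @factor_limit (k.+1 + n) [::] isT.
  rewrite /= mkseqD rev_cat -catA => /factor_catr.
  by rewrite (addnC k.+1) mkseqD catA => /factor_catl.
- apply: (@factor_catl _ _ _ (mkseq (fun i => limit_word k (n + i)) k)).
  rewrite cat_cons -mkseqD addnC mkseq_limit_word -cat_cons -SRE -rev_rcons -mkseqS.
  have := @factor_limit (k.+1 + n) [:: m] isT.
  rewrite /= cats0 catA -[u m]revK -rev_cat -RE addnCA mkseqD rev_cat -catA.
  by move=> /factor_catr; rewrite (addnC k.+1) mkseqD catA => /factor_catl.
Qed.

End Limits.

Theorem theorem1 (T : finType) (w : nat -> T) (u : nat -> seq T)
  (w_ur : uniformly_recurrent w)
  (u_inj : injective u)
  (u_nonempty : forall m, u m <> [::])
  (u_factor : forall m, factor w (u m))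
  (u_concat : forall (k : nat) (v : 'I_k -> seq T),
      injective v -> (forall i, exists m, v i = u m) ->
      forall sigma : 'S_k, factor w (\big[cat/[::]]_(i < k) v (sigma i))) :
  periodic w \/
  ~ (exists C : nat, forall n, 1 <= n -> factor_complexity w n <= C * n).
Proof.
case: (pselect (periodic w)) => [|w_aper]; [by left|right].
have u_flatten := factor_flatten u_inj u_concat.
(* Pairing the words with their reversals makes the same indices serve both limits; the padding
   [w 0] stays outside the first [N] letters once [N <= size (u m)]. *)
have [G GP] := cluster_point (fun m i => (nth (w 0) (u m) i, nth (w 0) (rev (u m)) i)).
pose P i := (G i).1; pose S i := (G i).2.
have limitP N M : exists m, [/\ M <= m, N <= size (u m),
    take N (u m) = mkseq P N & take N (rev (u m)) = mkseq S N].
  have [M' M'P] := injective_size_unbounded N u_inj.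
  have [m mM mG] := GP N (maxn M M').
  move: mM; rewrite geq_max => /andP[Mm /M'P mN]; exists m; split=> //.
    have /(congr1 (map fst)) := mG; rewrite /mkseq -!map_comp => <-.
    by rewrite -(map_nth_iota0 (w 0)).
  have /(congr1 (map snd)) := mG; rewrite /mkseq -!map_comp => <-.
  by rewrite -(map_nth_iota0 (w 0)) ?size_rev.
pose K k := forall n, left_special w (mkseq (limit_word P S k) n).
apply: (@complexity_superlinear _ _ K (limit_word P S)) => //.
- by move=> N; exact: (left_special_limit_word w_ur u_flatten limitP).
- by move=> k k'; exact: (limit_word_sep w_ur u_flatten limitP).
Qed.
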